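(* Let $m \geq 3$ be an integer. Then $\alpha(C(W_{m,1}))=\alpha(C(C_m))+1$.
   Context: Graphs are finite and simple. For a graph $G$, the pair graph $C(G)$ (also called complete double vertex graph) is the graph whose vertices are all $2$-multisets of $V(G)$ (so $\{x,x\}$ is allowed), where two vertices $\{x,y\}$ and $\{u,v\}$ are adjacent if and only if $\{x,y\}\cap\{u,v\}=\{a\}$ (multiset intersection) for some $a$ and, writing $x=u=a$, the vertices $y$ and $v$ are adjacent in $G$; that is, the two multisets can be written as $\{a,y\}$ and $\{a,v\}$ with $yv$ an edge of $G$. $C_m$ is the cycle with $m$ vertices, and $C(C_m)$ is its pair graph. The wheel graph $W_{m,1}$ is the join $C_m+K_1$, where $K_1$ is the complete graph with one vertex (the join of two disjoint graphs adds all edges between them). $\alpha(G)$ denotes the independence number of $G$. *)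

(* Defs.v *)
From mathcomp Require Import all_boot.

Set Implicit Arguments.
Unset Strict Implicit.
Unset Printing Implicit Defensive.

Record sgraph := SGraph {
  vertex :> finType;
  edge : rel vertex;
  edge_sym : symmetric edge;
  edge_irrefl : irreflexive edge
}.

Definition independent (G : sgraph) (S : {set G}) : bool :=
  [forall x in S, forall y in S, ~~ edge x y].

Definition alpha (G : sgraph) : nat :=
  \max_(S : {set G} | independent S) #|S|.

(* The disequality only matters for m = 1, where i + 1 = i modulo m. *)
Definition cycle_rel (m : nat) : rel 'I_m := fun i j =>
  (i != j) && ((j == i.+1 %% m :> nat) || (i == j.+1 %% m :> nat)).

Lemma cycle_rel_sym m : symmetric (@cycle_rel m).
Proof. by move=> i j; rewrite /cycle_rel eq_sym orbC. Qed.

Lemma cycle_rel_irrefl m : irreflexive (@cycle_rel m).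
Proof. by move=> i; rewrite /cycle_rel eqxx. Qed.

Definition cycle_graph (m : nat) : sgraph :=
  SGraph (@cycle_rel_sym m) (@cycle_rel_irrefl m).

Definition complete_rel (n : nat) : rel 'I_n := fun i j => i != j.

Lemma complete_rel_sym n : symmetric (@complete_rel n).
Proof. by move=> i j; rewrite /complete_rel eq_sym. Qed.

Lemma complete_rel_irrefl n : irreflexive (@complete_rel n).
Proof. by move=> i; rewrite /complete_rel eqxx. Qed.

Definition complete_graph (n : nat) : sgraph :=
  SGraph (@complete_rel_sym n) (@complete_rel_irrefl n).

Definition join_rel (G H : sgraph) : rel (G + H)%type := fun x y =>
  match x, y with
  | inl u, inl v => edge u v
  | inr u, inr v => edge u v
  | _, _ => true
  end.

Lemma join_rel_sym G H : symmetric (@join_rel G H).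
Proof. by move=> [x|x] [y|y] //=; apply: edge_sym. Qed.

Lemma join_rel_irrefl G H : irreflexive (@join_rel G H).
Proof. by move=> [x|x] /=; apply: edge_irrefl. Qed.

Definition join_graph (G H : sgraph) : sgraph :=
  SGraph (@join_rel_sym G H) (@join_rel_irrefl G H).

Definition wheel_graph (m : nat) : sgraph :=
  join_graph (cycle_graph m) (complete_graph 1).

(* A 2-multiset is given by its multiplicity function, whose values are at
   most 2 and sum to 2. *)
Definition mset2 (V : finType) :=
  {f : {ffun V -> 'I_3} | \sum_(x : V) (f x : nat) == 2}.

Definition mult (V : finType) (M : mset2 V) (x : V) : nat := val M x.

(* Booleans are read as 0 or 1: [fun x => x == a] is the multiplicity function
   of {a}, and intersection is the pointwise minimum. *)
Definition meet_in (V : finType) (M N : mset2 V) (a : V) : bool :=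
  [forall x, minn (mult M x) (mult N x) == (x == a)].

Definition is_pair (V : finType) (M : mset2 V) (a y : V) : bool :=
  [forall x, mult M x == (x == a) + (x == y)].

Definition pair_rel (G : sgraph) : rel (mset2 G) := fun M N =>
  [exists a, meet_in M N a &&
    [exists y, exists v, [&& is_pair M a y, is_pair N a v & edge y v]]].

Lemma pair_rel_sym G : symmetric (@pair_rel G).
Proof.
have imp (M N : mset2 G) : pair_rel M N -> pair_rel N M.
  case/existsP=> a /andP[/forallP I /existsP[y /existsP[v /and3P[My Nv yv]]]].
  apply/existsP; exists a; apply/andP; split.
    by apply/forallP=> x; rewrite minnC.
  by apply/existsP; exists v; apply/existsP; exists y; rewrite Nv My edge_sym.
by move=> M N; apply/idP/idP; apply: imp.
Qed.

Lemma pair_rel_irrefl G : irreflexive (@pair_rel G).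
Proof.
move=> M; apply/negbTE/existsP=> -[a /andP[/forallP I _]].
have := valP M => /=; rewrite (eq_bigr (fun x : G => (x == a) : nat)).
  by rewrite (bigD1 a) //= eqxx big1 // => x /negbTE->.
by move=> x _; have := I x; rewrite minnn => /eqP.
Qed.

Definition pair_graph (G : sgraph) : sgraph :=
  SGraph (@pair_rel_sym G) (@pair_rel_irrefl G).

(* Main.v *)
Require Import Defs.
From mathcomp Require Import all_boot.

(** Let [c] be the apex of the cone over [G]. Send [{x,y}] to itself and [{x,c}]
    to [{x,x}] for [x], [y] in [G]. This is injective on an independent set [S]
    of the pair graph of the cone, because [{x,c}] is adjacent to [{x,x}]. The
    image is independent: a pair [{x,y}] next to [{x,x}] is also adjacent to
    [{x,c}], and pairs [{x,x}] are never adjacent to each other. As only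
    [{c,c}] is lost, [S] has at most one element more than the image.
    Conversely, [{c,c}] can be added to any independent set of the pair graph
    of [G]. *)

Set Implicit Arguments.
Unset Strict Implicit.
Unset Printing Implicit Defensive.

(** * Multisets of size 2 as unordered pairs *)

Section Pairs.
Variable V : finType.
Implicit Types (x y u v : V) (M N : mset2 V).

Lemma mult_eq M N : mult M =1 mult N -> M = N.
Proof. by move=> eqMN; apply/val_inj/ffunP=> x; apply/val_inj/eqMN. Qed.

Lemma sum_pred1 x : \sum_(z : V) (z == x : nat) = 1.
Proof. by rewrite (bigD1 x) //= eqxx big1 // => z /negbTE->. Qed.

Lemma pair_of_subproof x y :
  \sum_(z : V) ([ffun z => inord ((z == x) + (z == y))] z : 'I_3) == 2.
Proof.
rewrite (eq_bigr (fun z => (z == x) + (z == y))) => [|z _]; last first.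
  (* The two Booleans add up to at most 2, so [inord] never falls back on its default value. *)
  by rewrite ffunE inordK //; case: (z == x); case: (z == y).
by rewrite big_split /= !sum_pred1.
Qed.

Definition pair_of x y : mset2 V :=
  exist (fun f : {ffun V -> 'I_3} => \sum_(z : V) (f z : nat) == 2) _
        (pair_of_subproof x y).

Lemma mult_pair_of x y z : mult (pair_of x y) z = (z == x) + (z == y).
Proof. by rewrite /mult /= ffunE inordK //; case: (z == x); case: (z == y). Qed.

Lemma pair_ofC x y : pair_of x y = pair_of y x.
Proof. by apply: mult_eq => z; rewrite !mult_pair_of addnC. Qed.

(** The multiplicity of [x] is positive, so [x] is [u] or [v]; cancelling it and evaluating at [y]
    identifies the other element. *)
Lemma pair_of_inj x y u v :
  pair_of x y = pair_of u v -> (x = u /\ y = v) \/ (x = v /\ y = u).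
Proof.
move=> e; have E z : (z == x) + (z == y) = (z == u) + (z == v).
  by rewrite -!mult_pair_of e.
have := E x; rewrite eqxx.
have [xu _|_] := eqVneq x u.
  left; split=> //; apply/eqP; have := E y.
  by rewrite -xu eqxx => /addnI; case: (y == v).
have [xv _|_] := eqVneq x v; last by case: (x == y).
right; split=> //; apply/eqP; have := E y.
by rewrite -xv eqxx addnC => /addIn; case: (y == u).
Qed.

Lemma is_pairE M x y : is_pair M x y = (M == pair_of x y).
Proof.
apply/forallP/eqP=> [e | -> z]; last by rewrite mult_pair_of.
by apply: mult_eq => z; rewrite mult_pair_of; apply/eqP.
Qed.

(** Multiplicities with sum 2 have a positive value at some [x]. Removing one copy of [x] leaves sum
    1, hence a single element [y], possibly equal to [x]. The Boolean equality lets [xchoose]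
    extract the two elements. *)
Lemma pair_of_surj M : exists p : V * V, M == pair_of p.1 p.2.
Proof.
have sumM : \sum_z mult M z = 2 by apply/eqP/(valP M).
have [x x_gt0] : exists x, 0 < mult M x.
  apply/existsP; apply: contraTT (eqxx 2) => /existsPn M0.
  by rewrite -[X in X == _]sumM big1 // => z _; have := M0 z; case: (mult M z).
have sumMx : \sum_z (mult M z - (z == x)) = 1.
  have : \sum_z (mult M z - (z == x)) + \sum_z (z == x) = 2.
    rewrite -big_split -[RHS]sumM; apply: eq_bigr => z _ /=.
    by rewrite subnK //; case: eqP => // ->.
  by rewrite sum_pred1 addn1 => -[].
have [y y_gt0] : exists y, 0 < mult M y - (y == x).
  apply/existsP; apply: contraTT (eqxx 1) => /existsPn M0.
  by rewrite -[X in X == _]sumMx big1 // => z _; have := M0 z; case: (_ - _).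
(* A second positive term besides the one at [y] would push the sum 1 up to at least 2. *)
have rest z : z != y -> mult M z - (z == x) = 0.
  move=> zy; move: sumMx; rewrite (bigD1 y) //= (bigD1 z) //=.
  by case: (mult M y - _) y_gt0 => // k _; case: (mult M z - _) => // l;
    rewrite addSn addnC.
have yE : mult M y - (y == x) = 1.
  by rewrite -[RHS]sumMx (bigD1 y) //= big1 ?addn0.
exists (x, y); apply/eqP/mult_eq=> z; rewrite mult_pair_of /=.
have zx : (z == x) <= mult M z by case: eqP => // ->.
have [->|/rest e] := eqVneq z y; last by rewrite -(subnK zx) e add0n addn0.
have yx : (y == x) <= mult M y by case: eqP => // ->.
by rewrite -(subnK yx) yE addnC.
Qed.

Variant pair_spec : mset2 V -> Type := PairSpec x y : pair_spec (pair_of x y).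

Lemma pairP M : pair_spec M.
Proof. by have /eqP-> := xchooseP (pair_of_surj M). Qed.

(** The order of the two elements is an arbitrary choice, so the value is meaningful when [f] is
    symmetric. *)
Definition pair_lift (T : Type) (f : V -> V -> T) M : T :=
  let p := xchoose (pair_of_surj M) in f p.1 p.2.

Lemma pair_liftE (T : Type) (f : V -> V -> T) x y :
  (forall u v, f u v = f v u) -> pair_lift f (pair_of x y) = f x y.
Proof.
move=> fC; rewrite /pair_lift.
case: (xchoose _) (xchooseP (pair_of_surj (pair_of x y))) => u v /=.
by move/eqP/pair_of_inj=> [[-> ->]|[-> ->]].
Qed.

End Pairs.

(** * Adjacency in pair graphs, and independent sets *)

Lemma pair_edgeP (G : sgraph) (M N : mset2 G) :
  reflect (exists a y v, [/\ M = pair_of a y, N = pair_of a v & edge y v])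
          (pair_rel M N).
Proof.
apply: (iffP existsP) => [[a /andP[_]]|[a [y [v [-> -> yv]]]]].
  case/existsP=> y /existsP[v]; rewrite !is_pairE => /and3P[/eqP-> /eqP-> yv].
  by exists a, y, v.
exists a; apply/andP; split; last first.
  by apply/existsP; exists y; apply/existsP; exists v; rewrite !is_pairE !eqxx.
(* Once the common [a] is taken out, the rest of the intersection is that of [{y}] and [{v}], which
   is empty because adjacent vertices are distinct. *)
apply/forallP=> z; rewrite !mult_pair_of -addn_minr.
have [->|_] := eqVneq z y; last by rewrite min0n addn0.
have [e|_] := eqVneq y v; last by rewrite minn0 addn0.
by move: yv; rewrite e edge_irrefl.
Qed.

Lemma pair_edge (G : sgraph) (a y v : G) :
  edge y v -> @pair_rel G (pair_of a y) (pair_of a v).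
Proof. by move=> yv; apply/pair_edgeP; exists a, y, v. Qed.

(** Both the shared and the replaced element of [{x,x}] are [x], so a neighbour arises by moving one
    copy of [x] along an edge. *)
Lemma pair_edge_loop (G : sgraph) (x u v : G) :
  @pair_rel G (pair_of x x) (pair_of u v) ->
  (u = x /\ edge x v) \/ (v = x /\ edge x u).
Proof.
case/pair_edgeP=> a [y [w [/pair_of_inj e1 /pair_of_inj e2 yw]]].
have [xa xy] : x = a /\ x = y by case: e1 => -[].
by move: e2 yw; rewrite -xa -xy => -[] [-> ->]; [left|right].
Qed.

Lemma independentP (G : sgraph) (S : {set G}) :
  reflect {in S &, forall x y, ~~ edge x y} (independent S).
Proof.
apply: (iffP forall_inP) => [indS x y xS yS | indS x xS].
  by have /forall_inP := indS x xS; apply.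
by apply/forall_inP=> y yS; apply: indS.
Qed.

Lemma independent_le_alpha (G : sgraph) (S : {set G}) :
  independent S -> #|S| <= alpha G.
Proof. by move=> indS; apply: (leq_bigmax_cond (F := fun S : {set G} => #|S|)). Qed.

Lemma alpha_attained (G : sgraph) : exists2 S : {set G}, independent S & alpha G = #|S|.
Proof.
have ind0 : independent (set0 : {set G}) by apply/independentP=> x y; rewrite inE.
have [|S indS eS] := @eq_bigmax_cond _ (@independent G) (fun S : {set G} => #|S|).
  by apply/card_gt0P; exists set0.
by exists S.
Qed.

(** * Pair graph of a cone: embedding of the base and lower bound *)

Section Cone.
Variable G : sgraph.
Notation cone := (join_graph G (complete_graph 1)).
Let apex : cone := inr ord0.
Implicit Types (x y : G) (S : {set pair_graph cone}).

Definition cone_pair : mset2 G -> mset2 cone :=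
  pair_lift (fun x y => pair_of (inl x : cone) (inl y : cone)).

Lemma cone_pairE x y : cone_pair (pair_of x y) = pair_of (inl x : cone) (inl y : cone).
Proof. by apply: pair_liftE => u v; apply: pair_ofC. Qed.

Lemma cone_pair_eq M (p q : cone) : cone_pair M = pair_of p q ->
  exists x y, [/\ p = inl x, q = inl y & M = pair_of x y].
Proof.
case: (pairP M) => x y; rewrite cone_pairE => /pair_of_inj[] [<- <-].
  by exists x, y.
by exists y, x; rewrite pair_ofC.
Qed.

Lemma cone_pair_inj : injective cone_pair.
Proof.
move=> M N; case: (pairP N) => x y; rewrite cone_pairE.
by case/cone_pair_eq=> _ [_ [[<-] [<-] ->]].
Qed.

Lemma cone_pair_edge (M N : mset2 G) :
  @pair_rel cone (cone_pair M) (cone_pair N) = @pair_rel G M N.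
Proof.
apply/pair_edgeP/pair_edgeP=> [[p [q [r []]]]|[a [y [v [-> -> yv]]]]].
  case/cone_pair_eq=> a [y [-> -> ->]].
  case/cone_pair_eq=> _ [v [[<-] -> ->]] yv.
  by exists a, y, v.
by exists (inl a), (inl y), (inl v); rewrite !cone_pairE.
Qed.

(** Every neighbour of [{c,c}] still contains [c], so none lies in the image of [cone_pair]. *)
Lemma alpha_cone_ge : alpha (pair_graph G) < alpha (pair_graph cone).
Proof.
have [S /independentP indS ->] := alpha_attained (pair_graph G).
pose T : {set pair_graph cone} := pair_of apex apex |: cone_pair @: S.
have cc_notin (M : mset2 G) : pair_of apex apex <> cone_pair M.
  by case: (pairP M) => x y; rewrite cone_pairE => /pair_of_inj[] [].
have cc_free (M : mset2 G) : ~~ @pair_rel cone (pair_of apex apex) (cone_pair M).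
  case: (pairP M) => x y; rewrite cone_pairE.
  by apply/negP=> /pair_edge_loop[] [].
have -> : #|S|.+1 = #|T|.
  rewrite cardsU1 (card_imset _ cone_pair_inj).
  by case: imsetP => // -[M _ /cc_notin].
apply/independent_le_alpha/independentP=> M N /setU1P[->|/imsetP[M' SM' ->]].
  by case/setU1P=> [->|/imsetP[N' _ ->]] //=; rewrite pair_rel_irrefl.
case/setU1P=> [->|/imsetP[N' SN' ->]] /=; first by rewrite pair_rel_sym.
by rewrite cone_pair_edge; apply: indS.
Qed.

(** * The collapsing map and the upper bound *)

Definition collapse_pair (p q : cone) : option (mset2 G) :=
  match p, q with
  | inl x, inl y => Some (pair_of x y)
  | inl x, inr _ | inr _, inl x => Some (pair_of x x)
  | inr _, inr _ => None
  end.

Definition collapse : mset2 cone -> option (mset2 G) := pair_lift collapse_pair.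

Lemma collapseE (p q : cone) : collapse (pair_of p q) = collapse_pair p q.
Proof. by apply: pair_liftE => -[u|u] [v|v] //=; rewrite pair_ofC. Qed.

Variant cone_spec : mset2 cone -> Type :=
  | ConeBase x y : cone_spec (pair_of (inl x : cone) (inl y : cone))
  | ConeSpoke x : cone_spec (pair_of (inl x : cone) apex)
  | ConeApex : cone_spec (pair_of apex apex).

Lemma coneP (M : mset2 cone) : cone_spec M.
Proof.
case: (pairP M) => -[x|i] [y|j]; rewrite ?(ord1 i) ?(ord1 j); try by constructor.
by rewrite pair_ofC; constructor.
Qed.

Lemma spoke_edge x y :
  @pair_rel cone (pair_of (inl x : cone) apex) (pair_of (inl x : cone) (inl y : cone)).
Proof. exact: pair_edge. Qed.

Lemma collapse_inj S : independent S -> {in S &, injective collapse}.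
Proof.
move/independentP=> indS M N; case: (coneP M) => [x y|x|]; case: (coneP N) => [u v|u|];
  move=> SM SN; rewrite !collapseE //= => /Some_inj/pair_of_inj e.
- by case: e => -[-> ->] //; rewrite pair_ofC.
- have [xu yu] : x = u /\ y = u by case: e => -[].
  by have := indS _ _ SN SM; rewrite xu yu /= spoke_edge.
- have [ux vx] : u = x /\ v = x by case: e => -[].
  by have := indS _ _ SM SN; rewrite ux vx /= spoke_edge.
- by case: e => -[->].
Qed.

(** Edges lift back along [collapse], so it sends independent sets to independent sets. If [{x,x}]
    is adjacent to [{u,v}], then [{u,v}] contains [x], and [{x,c}] is adjacent to every such pair
    because [c] is joined to all of [G]. *)
Lemma collapse_edge (M N : mset2 cone) (M' N' : mset2 G) :
  collapse M = Some M' -> collapse N = Some N' -> pair_rel M' N' -> pair_rel M N.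
Proof.
have spoke x u v : @pair_rel G (pair_of x x) (pair_of u v) ->
    @pair_rel cone (pair_of (inl x : cone) apex) (pair_of (inl u : cone) (inl v : cone)).
  case/pair_edge_loop=> -[-> _]; first exact: spoke_edge.
  by rewrite [X in pair_rel _ X]pair_ofC; apply: spoke_edge.
case: (coneP M) => [x y|x|]; case: (coneP N) => [u v|u|];
  rewrite !collapseE //= => /Some_inj<- /Some_inj<-.
- by rewrite -!cone_pairE cone_pair_edge.
- by rewrite pair_rel_sym => /spoke; rewrite pair_rel_sym.
- exact: spoke.
- by case/pair_edge_loop=> -[->]; rewrite edge_irrefl.
Qed.

Lemma alpha_cone_le : alpha (pair_graph cone) <= (alpha (pair_graph G)).+1.
Proof.
apply/bigmax_leqP=> S indS.
pose T : {set pair_graph G} := [set M | Some M \in collapse @: S].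
have indT : independent T.
  apply/independentP=> M' N'; rewrite !inE => /imsetP[M SM eM] /imsetP[N SN eN].
  apply: contra (independentP _ indS _ _ SM SN); exact: collapse_edge.
rewrite -(card_in_imset (collapse_inj indS)).
(* The image of [S] lies in a copy of [T] together with [None], the value at [{c,c}]; this one extra
   point is the successor in the bound. *)
apply: leq_trans (_ : #|None |: Some @: T| <= _).
  apply/subset_leq_card/subsetP=> -[M|] SM; rewrite !inE //=.
  by apply: imset_f; rewrite inE.
rewrite cardsU1 (leq_trans (leq_add (leq_b1 _) (leq_imset_card _ _))) //.
by rewrite add1n ltnS independent_le_alpha.
Qed.

Lemma alpha_pair_cone : alpha (pair_graph cone) = alpha (pair_graph G) + 1.
Proof. by apply/eqP; rewrite addn1 eqn_leq alpha_cone_le alpha_cone_ge. Qed.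

End Cone.

Theorem theorem1p6 (m : nat) (hm : 3 <= m) :
  alpha (pair_graph (wheel_graph m)) = alpha (pair_graph (cycle_graph m)) + 1.
(* By definition the wheel is the cone over the cycle. *)
Proof. exact: alpha_pair_cone. Qed.
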